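(* Let $k\ge 2$. If $X_1,X_2,X_3\subseteq V(G_k)$ satisfy $X_1\cup X_2\cup X_3=V(G_k)$, then at least one of $X_1,X_2,X_3$ is not small.
   Context: $G_k$ is the $k\times k$-grid with vertex set $\{(i,j):1\le i,j\le k\}$ and edges $(i,j)(i',j')$ with $|i-i'|+|j-j'|=1$. $R_j=\{(i,j):1\le i\le k\}$ is the $j$-th row. For $X\subseteq V(G_k)$, $\operatorname{mm}(X)$ is the size of a maximum matching in $G_k$ among the edges with one end in $X$ and the other in $V(G_k)\setminus X$. A set $X\subseteq V(G_k)$ is small if $\operatorname{mm}(X)<k$ and $R_i\not\subseteq X$ for all $i=1,\dots,k$. *)

(* Defs.v *)
From mathcomp Require Import all_boot all_order all_algebra.

Set Implicit Arguments.
Unset Strict Implicit.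
Unset Printing Implicit Defensive.

(* The coordinates 1, ..., k are represented by the elements 0, ..., k - 1
   of 'I_k. *)
Definition grid (k : nat) : finType := ('I_k * 'I_k)%type.

Definition grid_adj (k : nat) : rel (grid k) :=
  fun u v => (`|u.1 - v.1| + `|u.2 - v.2| == 1)%N.

Definition grid_edges (k : nat) : {set {set grid k}} :=
  [set [set p.1; p.2] | p : grid k * grid k & grid_adj p.1 p.2].

(* The row index is the second coordinate. *)
Definition grid_row (k : nat) (j : 'I_k) : {set grid k} :=
  [set u : grid k | u.2 == j].

Definition crossing_edges (k : nat) (X : {set grid k}) : {set {set grid k}} :=
  [set e in grid_edges k |
    [exists u in X, exists v in ~: X, e == [set u; v]]].

Definition grid_matching (k : nat) (M : {set {set grid k}}) : bool :=
  (M \subset grid_edges k) && trivIset M.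

Definition mm (k : nat) (X : {set grid k}) : nat :=
  \max_(M : {set {set grid k}} |
         grid_matching M && (M \subset crossing_edges X)) #|M|.

Definition small (k : nat) (X : {set grid k}) : Prop :=
  mm X < k /\ forall j : 'I_k, ~ (grid_row j \subset X).

(* Main.v *)
Require Import Defs.
From mathcomp Require Import all_boot all_order all_algebra zify.

Set Implicit Arguments.
Unset Strict Implicit.
Unset Printing Implicit Defensive.

(** A set [X] with [mm X < k] has, by König's theorem, a set [S] of fewer than
    [k] vertices that meets every edge leaving [X]. Some row and some column
    avoid [S]; all such lines are joined to each other outside [S], so if [X]
    contains no row they are all disjoint from [X]. Suppose three such sets
    cover the grid, and argue by induction on [k].
    If each [S_i] meets the union of one horizontal and one vertical side of
    the grid, the same for all [i], delete these two sides: each [S_i] loses a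
    vertex and the smaller grid is a counterexample. Otherwise some [S_i], say
    [S_1], misses two opposite sides, say left and right, so [X_1] misses these
    sides and [X_2], [X_3] cover them. If an end of a row lies in [X_i], then
    [S_i] meets the part of the row between that end and an [S_i]-free column;
    counting both ends of all rows gives [#|S_2| + #|S_3| >= 2k],
    a contradiction. *)

(** * König's theorem *)

Section Konig.
Variable V : finType.
Implicit Types (X S e f : {set V}) (E M : {set {set V}}).

Definition bipartite X E :=
  forall e, e \in E -> exists u v, [/\ u \in X, v \notin X & e = [set u; v]].

Definition covers S E := [forall e in E, e :&: S != set0].

(** The cover number of [E] is at least [n]. This is monotone in [E], so it can be minimised over
    subfamilies. *)
Definition needs n E := [forall S, covers S E ==> (n <= #|S|)].

Lemma bipartiteC X E : bipartite X E -> bipartite (~: X) E.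
Proof.
move=> bE e /bE [u [v [uX vX ->]]]; exists v, u.
by rewrite !inE negbK vX uX setUC.
Qed.

Lemma set2I_neq0 (a b : V) S :
  ([set a; b] :&: S != set0) = (a \in S) || (b \in S).
Proof.
apply/set0Pn/orP => [[x /setIP[/set2P[]-> ?]]|[] ?]; [by left|by right|..].
- by exists a; rewrite !inE eqxx.
- by exists b; rewrite !inE eqxx orbT.
Qed.

(* Two covers, each missing one of two edges that share [a], can be uncrossed
   along the bipartition into two covers, one of which is too cheap. *)
Lemma needs_minimal_disjoint X E n (a : V) e f :
    bipartite X E -> minset (needs n) E -> e \in E -> f \in E ->
  a \in X -> a \in e -> a \in f -> e = f.
Proof.
move=> bE /minsetP[/forallP nE minE] eE fE aX ae af.
apply/eqP; case: eqVneq => // nef; exfalso.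
(* By minimality, dropping [g] admits a cover with fewer than [n] vertices; it misses [g], or it
   would cover all of [E]. *)
have miss g : g \in E ->
    exists S, [/\ covers S (E :\ g), g :&: S = set0 & #|S| < n].
  move=> gE; have : ~~ needs n (E :\ g).
    apply/negP => /minE/(_ (subsetDl _ _))/setP/(_ g).
    by rewrite !inE eqxx gE.
  case/forallPn=> S; rewrite negb_imply -ltnNge => /andP[cS ltS].
  exists S; split=> //; apply/eqP; apply: contraTT ltS => gS.
  rewrite -leqNgt; apply: (implyP (nE S)); apply/forall_inP => h hE.
  have [->//|nhg] := eqVneq h g.
  by apply: (forall_inP cS); rewrite !inE nhg.
have [Se [cSe eSe ltSe]] := miss e eE.
have [Sf [cSf fSf ltSf]] := miss f fE.
have aSe : a \notin Se.
  by apply/negP => aS; move/setP/(_ a): eSe; rewrite !inE ae aS.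
have aSf : a \notin Sf.
  by apply/negP => aS; move/setP/(_ a): fSf; rewrite !inE af aS.
pose C1 := (X :&: (Se :&: Sf)) :|: (~: X :&: (Se :|: Sf)).
pose C2 := (X :&: (Se :|: Sf)) :|: (~: X :&: (Se :&: Sf)).
have cardC (A B C : {set V}) : #|(A :&: B) :|: (~: A :&: C)| = #|A :&: B| + #|~: A :&: C|.
  rewrite cardsU [_ :&: (_ :&: _)](_ : _ = set0) ?cards0 ?subn0 //.
  by apply/setP => x; rewrite !inE; case: (x \in A); rewrite ?andbF.
have cost : #|C1| + #|C2| = #|Se| + #|Sf|.
  rewrite !cardC -(cardsID X Se) -(cardsID X Sf).
  have eqs (A B C : {set V}) : #|A :&: (B :&: C)| + #|A :&: (B :|: C)| = #|B :&: A| + #|C :&: A|.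
    by rewrite setIUr setIIr addnC cardsUI [B :&: A]setIC [C :&: A]setIC.
  move: (eqs X Se Sf) (eqs (~: X) Se Sf); rewrite -!setDE; clear; lia.
have other g : g \in E -> g != e -> g != f ->
    (g :&: Se != set0) && (g :&: Sf != set0).
  move=> gE ge gf; apply/andP; split.
  - by apply: (forall_inP cSe); rewrite !inE ge.
  - by apply: (forall_inP cSf); rewrite !inE gf.
(* As [Se] and [Sf] avoid [a], the one that meets [e] or [f] does so at the end outside [X], where
   [C1] contains the union. *)
have c1 : covers C1 E.
  apply/forall_inP => g gE; have [u [v [uX vX eg]]] := bE g gE.
  have au : a \in g -> u = a.
    by rewrite eg !inE => /orP[/eqP-> //|/eqP va]; rewrite -va aX in vX.
  have [/eqP ge|ge] := boolP (g == e).
    have : g :&: Sf != set0 by apply: (forall_inP cSf); rewrite !inE ge nef.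
    rewrite {1 2}eg !set2I_neq0 !inE au ?ge // (negPf aSf) aX (negPf vX) /=.
    by move=> ->; rewrite ?orbT.
  have [/eqP gf|gf] := boolP (g == f).
    have : g :&: Se != set0 by apply: (forall_inP cSe); rewrite !inE gf eq_sym nef.
    rewrite {1 2}eg !set2I_neq0 !inE au ?gf // (negPf aSe) aX (negPf vX) /=.
    by move=> ->; rewrite ?orbT.
  move: (other g gE ge gf); rewrite eg !set2I_neq0 !inE uX (negPf vX) /=.
  by do 4 case: (_ \in _).
(* Only [e] and [f] can escape [C2], and both contain [a]. *)
have c2 : covers (a |: C2) E.
  apply/forall_inP => g gE; have [u [v [uX vX eg]]] := bE g gE.
  have [ag|ag] := boolP (a \in g); first by apply/set0Pn; exists a; rewrite !inE eqxx ag.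
  have ge : g != e by apply: contraNneq ag => ->.
  have gf : g != f by apply: contraNneq ag => ->.
  move: (other g gE ge gf); rewrite eg !set2I_neq0 !inE uX (negPf vX) /=.
  by do 4 case: (_ \in _); rewrite ?orbT.
move: (implyP (nE C1) c1) (implyP (nE (a |: C2)) c2).
rewrite cardsU1 => n1 n2; move: n1 n2 cost ltSe ltSf; clear.
by case: (a \in C2) => /=; lia.
Qed.

(** A minimal subfamily that still needs [n] vertices is a matching: two of its edges can share a
    vertex on neither side. One vertex from each edge covers it, so it has at least [n] edges. *)
Lemma konig X E n : bipartite X E -> needs n E ->
  exists M, [/\ M \subset E, trivIset M & n <= #|M|].
Proof.
move=> bE /minset_exists[M minM sME]; exists M.
have bM : bipartite X M by move=> e /(subsetP sME)/bE.
split=> //.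
  apply/trivIsetP => e f eM fM; apply: contraNT => /pred0Pn[a /andP[/= ae af]].
  apply/eqP; have [aX|aX] := boolP (a \in X).
    exact: (needs_minimal_disjoint bM minM eM fM aX).
  by apply: (needs_minimal_disjoint (bipartiteC bM) minM eM fM _ ae af); rewrite inE.
have [/forallP nM _] := minsetP minM.
pose S := [set x | [exists e in M, [pick x in e] == Some x]].
have cS : covers S M.
  apply/forall_inP => e eM; have [u [v [_ _ ee]]] := bM e eM.
  case E1: [pick x in e] => [x|].
    have xe : x \in e by move: E1; case: pickP => // y ye [<-].
    by apply/set0Pn; exists x; rewrite !inE xe; apply/exists_inP; exists e; rewrite ?E1.
  by move: E1; case: pickP => // /(_ u); rewrite ee !inE eqxx.
apply: leq_trans (implyP (nM S) cS) _.
rewrite -(card_imset _ (@Some_inj _)).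
apply: leq_trans (leq_imset_card (fun e : {set V} => [pick x in e]) M).
apply: subset_leq_card; apply/subsetP => _ /imsetP[x xS ->].
by move: xS; rewrite inE => /exists_inP[e eM /eqP <-]; apply: imset_f.
Qed.

End Konig.

(** Otherwise König's theorem, with [X] as one side of the bipartition, yields [k] disjoint crossing
    edges. *)
Lemma mm_cover k (X : {set grid k}) : mm X < k ->
  exists2 S : {set grid k}, #|S| < k &
    forall u v, grid_adj u v -> u \in X -> v \notin X -> (u \in S) || (v \in S).
Proof.
move=> ltk; have bE : bipartite X (crossing_edges X).
  move=> e; rewrite inE => /andP[_ /exists_inP[u uX /exists_inP[v]]].
  by rewrite inE => vX /eqP ->; exists u, v.
case: (boolP (needs k (crossing_edges X))) => [/(konig bE)[M [sM tM kM]]|].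
  have : #|M| <= mm X.
    apply: (@leq_bigmax_cond _ (fun M => grid_matching M && (M \subset crossing_edges X)) (fun M => #|M|)).
    rewrite /grid_matching sM tM !andbT; apply: subset_trans sM _.
    by apply/subsetP => e; rewrite inE => /andP[].
  by rewrite leqNgt (leq_trans ltk kM).
case/forallPn => S; rewrite negb_imply -ltnNge => /andP[cS ltS].
exists S => // u v uv uX vX; rewrite -set2I_neq0; apply: (forall_inP cS).
rewrite inE; apply/andP; split.
  by apply/imsetP; exists (u, v) => //; rewrite inE.
by apply/exists_inP; exists u => //; apply/exists_inP; exists v; rewrite ?inE.
Qed.

(** * Three small sides in a square box *)

(** Boxes are given by corner and side length in the plane of naturals, so that deleting sides in
    the induction needs no reindexing. *)
Definition inside (a k i : nat) := a <= i < a + k.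

Record separates (a b k : nat) (S : seq (nat * nat)) (X : nat -> nat -> bool) : Prop :=
  Separates {
    sep_horizontal : forall i j, inside a k i -> inside a k i.+1 -> inside b k j ->
      X i j != X i.+1 j -> ((i, j) \in S) || ((i.+1, j) \in S);
    sep_vertical : forall i j, inside a k i -> inside b k j -> inside b k j.+1 ->
      X i j != X i j.+1 -> ((i, j) \in S) || ((i, j.+1) \in S) }.

(* [S] may have points outside the box: only its size matters. *)
Record small_side (a b k : nat) (S : seq (nat * nat)) (X : nat -> nat -> bool) : Prop :=
  SmallSide {
    small_sep : separates a b k S X;
    small_size : size S < k;
    free_row : forall j, inside b k j -> j \notin map snd S ->
      forall i, inside a k i -> ~~ X i j;
    free_col : forall i, inside a k i -> i \notin map fst S ->
      forall j, inside b k j -> ~~ X i j }.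

Lemma line_separated (X S : nat -> bool) l h :
    (forall i, l <= i < h -> X i != X i.+1 -> S i || S i.+1) ->
  l <= h -> X l != X h -> exists2 i, l <= i <= h & S i.
Proof.
move=> sep; elim: h sep => [|h IHh] sep.
  by rewrite leqn0 => /eqP->; rewrite eqxx.
rewrite leq_eqVlt => /orP[/eqP->|lh]; first by rewrite eqxx.
have [<-|Xh] := eqVneq (X h) (X h.+1); last first.
  move=> _; have ih : l <= h < h.+1 by lia.
  have [Sh|Sh] := orP (sep h ih Xh).
  - by exists h => //; lia.
  - by exists h.+1 => //; lia.
move=> Xl; case: IHh => //.
  by move=> i ih; apply: sep; lia.
by move=> i ih Si; exists i => //; lia.
Qed.

Lemma exists_free (S : seq nat) a k : size S < k ->
  exists2 i, inside a k i & i \notin S.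
Proof.
move=> ltS; have : ~~ all (mem S) (iota a k).
  apply: contraTN ltS => /allP sub; rewrite -leqNgt -{1}(size_iota a k).
  exact: uniq_leq_size (iota_uniq _ _) _.
by case/allPn => i; rewrite mem_iota => ia iS; exists i.
Qed.

Definition swap (p : nat * nat) := (p.2, p.1).

Lemma mem_map_swap S i j : ((i, j) \in map swap S) = ((j, i) \in S).
Proof.
have inj : injective swap by move=> [? ?] [? ?] [-> ->].
by rewrite -[(i, j)]/(swap (j, i)) mem_map.
Qed.

Lemma separates_swap a b k S X :
  separates a b k S X -> separates b a k (map swap S) (fun i j => X j i).
Proof.
by case=> sh sv; split=> i j *; rewrite !mem_map_swap; [apply: sv|apply: sh].
Qed.

Lemma fst_swap S : map fst (map swap S) = map snd S.
Proof. by rewrite -map_comp. Qed.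

Lemma snd_swap S : map snd (map swap S) = map fst S.
Proof. by rewrite -map_comp. Qed.

(** Transposition exchanges [free_row] and [free_col]; the record demands both so that rows and
    columns can be treated alike. *)
Lemma small_side_swap a b k S X :
  small_side a b k S X -> small_side b a k (map swap S) (fun i j => X j i).
Proof.
case=> sep sz fr fc.
split; rewrite ?size_map ?fst_swap ?snd_swap //; first exact: separates_swap.
Qed.

Lemma row_hit a b k S X l h j : separates a b k S X ->
    inside b k j -> inside a k l -> inside a k h -> l <= h -> X l j != X h j ->
  exists2 i, l <= i <= h & (i, j) \in S.
Proof.
move=> sS jb la ha lh Xlh.
apply: (line_separated (X := X^~ j) (S := fun i => (i, j) \in S)) => // i ih.
by apply: (sep_horizontal sS) => //; move: la ha; rewrite /inside; lia.
Qed.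

Lemma row_const a b k S X j i i' : separates a b k S X -> inside b k j ->
    j \notin map snd S -> inside a k i -> inside a k i' -> X i j = X i' j.
Proof.
move=> sS jb jS.
wlog le : i i' / i <= i'.
  by move=> W ia ia'; case/orP: (leq_total i i') => le; [|symmetry]; apply: W.
move=> ia ia'; apply/eqP; apply: contraNT jS => ne.
by have [x _ /(map_f snd)] := row_hit sS jb ia ia' le ne.
Qed.

Lemma col_const a b k S X i j j' : separates a b k S X -> inside a k i ->
    i \notin map fst S -> inside b k j -> inside b k j' -> X i j = X i j'.
Proof.
move=> /separates_swap sS ia iS; apply: (row_const sS ia).
by rewrite snd_swap.
Qed.

Definition inbox a b k (p : nat * nat) := inside a k p.1 && inside b k p.2.

(** Column [x] and row [y] are the deleted sides. [S] has a point on one of them, so its size drops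
    along with the side length. *)
Lemma small_side_shrink a b a' b' k S X x y :
    a <= a' <= a.+1 -> b <= b' <= b.+1 ->
    ~~ inside a' k x -> ~~ inside b' k y ->
    inside a k.+1 x -> inside b k.+1 y ->
    small_side a b k.+1 S X ->
    (x \in map fst S) || (y \in map snd S) ->
  small_side a' b' k [seq p <- S | inbox a' b' k p] X.
Proof.
move=> aa bb xa yb xa0 yb0 sS hit; have [sep sz fr fc] := sS.
have ina i : inside a' k i -> inside a k.+1 i by rewrite /inside; lia.
have inb j : inside b' k j -> inside b k.+1 j by rewrite /inside; lia.
have ina' i : inside a k.+1 i -> i != x -> inside a' k i.
  by move: xa xa0; rewrite /inside; lia.
have inb' i : inside b k.+1 i -> i != y -> inside b' k i.
  by move: yb yb0; rewrite /inside; lia.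
set S' := filter _ _.
have memS' i j : inside a' k i -> inside b' k j -> ((i, j) \in S') = ((i, j) \in S).
  by move=> ia jb; rewrite mem_filter /inbox /= ia jb.
have ltS' : size S' < k.
  apply: leq_trans (ltnSE sz).
  rewrite size_filter ltn_neqAle count_size andbT -all_count.
  apply/allPn; case/orP: hit => /mapP[p pS ep]; exists p => //.
  - by rewrite /inbox -ep (negPf xa).
  - by rewrite /inbox -ep (negPf yb) andbF.
have sep' : separates a' b' k S' X.
  split=> i j ia jb ij; rewrite !memS' //.
  - by apply: (sep_horizontal sep); auto.
  - by apply: (sep_vertical sep); auto.
have szf : size (map fst S) < k.+1 by rewrite size_map.
have szs : size (map snd S) < k.+1 by rewrite size_map.
have [c ca cS] := exists_free a szf; have [r rb rS] := exists_free b szs.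
have szf' : size (map fst S') < k by rewrite size_map.
have szs' : size (map snd S') < k by rewrite size_map.
have [c' ca' cS'] := exists_free a' szf'; have [r' rb' rS'] := exists_free b' szs'.
have sub1 i : i \notin map fst S -> i \notin map fst S'.
  by apply: contra => /mapP[p]; rewrite mem_filter => /andP[_ pS ->]; apply: map_f.
have sub2 i : i \notin map snd S -> i \notin map snd S'.
  by apply: contra => /mapP[p]; rewrite mem_filter => /andP[_ pS ->]; apply: map_f.
(* [S] meets column [x] or row [y], so the free lines [c] and [r] are not both
   removed; all free lines of the smaller box are joined to the remaining one. *)
have Xcr : ~~ X c' r'.
  have [cx|cx] := eqVneq c x.
    have ry : r != y.
      apply: contraTneq hit => ry; rewrite negb_or -cx -ry cS.
      exact: rS.
    rewrite (col_const (j' := r) sep') //; last exact: inb'.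
    by apply: fr => //; apply: ina.
  rewrite (row_const (i' := c) sep') //; last exact: ina'.
  by apply: fc => //; apply: inb.
split=> // [j jb jS i ia|i ia iS j jb].
- rewrite (row_const (i' := c') sep') // (col_const (j' := r') sep') //.
- rewrite (col_const (j' := r') sep') // (row_const (i' := c') sep') //.
Qed.

Definition covered a b k (X Y Z : nat -> nat -> bool) :=
  forall i j, inside a k i -> inside b k j -> [|| X i j, Y i j | Z i j].

(* Each row yields one point of [S2 ++ S3] to the left and one to the right of
   a free column. *)
Lemma opposite_sides_free a b k S1 S2 S3 X1 X2 X3 :
    small_side a b k.+1 S1 X1 -> small_side a b k.+1 S2 X2 ->
    small_side a b k.+1 S3 X3 -> covered a b k.+1 X1 X2 X3 ->
  a \notin map fst S1 -> a + k \notin map fst S1 -> False.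
Proof.
move=> s1 s2 s3 cov aS1 kS1.
have aa : inside a k.+1 a by rewrite /inside; lia.
have ka : inside a k.+1 (a + k) by rewrite /inside; lia.
have fc S X : small_side a b k.+1 S X ->
  exists c, [/\ inside a k.+1 c, c \notin map fst S &
    forall j, inside b k.+1 j -> ~~ X c j].
  move=> s; have sz : size (map fst S) < k.+1 by rewrite size_map (small_size s).
  have [c ca cS] := exists_free a sz; exists c; split=> //.
  exact: (free_col s).
have [c2 [ca2 cS2 X2c]] := fc _ _ s2; have [c3 [ca3 cS3 X3c]] := fc _ _ s3.
(* Cutting at a free column keeps the points found from the left and right ends apart, so none is
   counted twice. *)
pose lt c (p : nat * nat) := p.1 < c.
have hitl S X c j : small_side a b k.+1 S X -> inside a k.+1 c -> c \notin map fst S ->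
    ~~ X c j -> inside b k.+1 j -> X a j -> j \in map snd (filter (lt c) S).
  move=> s ca cS Xc jb Xa.
  have [||i ic iS] := row_hit (small_sep s) jb aa ca; [by case/andP: ca|by rewrite Xa (negPf Xc)|].
  apply/mapP; exists (i, j) => //; rewrite mem_filter iS andbT /lt /=.
  have ne : i != c by apply: contraNneq cS => <-; apply: (map_f fst iS).
  by move: ic ne; clear; lia.
have hitr S X c j : small_side a b k.+1 S X -> inside a k.+1 c -> c \notin map fst S ->
    ~~ X c j -> inside b k.+1 j -> X (a + k) j -> j \in map snd (filter (predC (lt c)) S).
  move=> s ca cS Xc jb Xa.
  have [||i ic iS] := row_hit (small_sep s) jb ca ka; [by move: ca; clear; rewrite /inside; lia|by rewrite Xa (negPf Xc)|].
  apply/mapP; exists (i, j) => //; rewrite mem_filter iS andbT /lt /=.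
  by move: ic; clear; lia.
have szl : k.+1 <= size (map snd (filter (lt c2) S2) ++ map snd (filter (lt c3) S3)).
  rewrite -{1}(size_iota b k.+1); apply: uniq_leq_size (iota_uniq _ _) _ => j.
  rewrite mem_iota => jb; rewrite mem_cat.
  move: (cov a j aa jb); rewrite (negPf (free_col s1 aa aS1 jb)) /=.
  case/orP => Xa; apply/orP; [left; apply: (hitl _ X2)|right; apply: (hitl _ X3)] => //.
  - exact: X2c.
  - exact: X3c.
have szr : k.+1 <= size (map snd (filter (predC (lt c2)) S2)
                      ++ map snd (filter (predC (lt c3)) S3)).
  rewrite -{1}(size_iota b k.+1); apply: uniq_leq_size (iota_uniq _ _) _ => j.
  rewrite mem_iota => jb; rewrite mem_cat.
  move: (cov (a + k) j ka jb); rewrite (negPf (free_col s1 ka kS1 jb)) /=.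
  case/orP => Xa; apply/orP; [left; apply: (hitr _ X2)|right; apply: (hitr _ X3)] => //.
  - exact: X2c.
  - exact: X3c.
(* The two halves give at least [2 * k.+1] points, but [S2] and [S3] have at most [k] each. *)
move: (small_size s2) (small_size s3) szl szr.
rewrite !size_cat !size_map !size_filter.
move: (count_predC (lt c2) S2) (count_predC (lt c3) S3); clear; lia.
Qed.

(** * Induction on the side length *)

(** The variables say which of the left, right, lower and upper sides each set meets. A set that
    misses both sides at one corner meets the other two, hence misses only that corner; three sets
    cannot spoil four corners. *)
Lemma common_corner (l1 r1 d1 u1 l2 r2 d2 u2 l3 r3 d3 u3 : bool) :
    (l1 || r1) && (d1 || u1) -> (l2 || r2) && (d2 || u2) ->
    (l3 || r3) && (d3 || u3) ->
    ~~ [&& l1 || d1, l2 || d2 & l3 || d3] ->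
    ~~ [&& l1 || u1, l2 || u2 & l3 || u3] ->
    ~~ [&& r1 || d1, r2 || d2 & r3 || d3] ->
  ~~ [&& r1 || u1, r2 || u2 & r3 || u3] -> False.
Proof.
by case: l1 r1 d1 u1 => [] [] [] [] //= _; case: l2 r2 d2 u2 => [] [] [] [] //= _;
  case: l3 r3 d3 u3 => [] [] [] [].
Qed.

Lemma small_sides_not_cover k a b S1 S2 S3 X1 X2 X3 :
    small_side a b k S1 X1 -> small_side a b k S2 X2 ->
    small_side a b k S3 X3 -> covered a b k X1 X2 X3 -> False.
Proof.
elim: k a b S1 S2 S3 => [|k IHk] a b S1 S2 S3 s1 s2 s3 cov.
  by have := small_size s1.
have opp S S' S'' X X' X'' : small_side a b k.+1 S X -> small_side a b k.+1 S' X' ->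
    small_side a b k.+1 S'' X'' -> covered a b k.+1 X X' X'' ->
    ((a \in map fst S) || (a + k \in map fst S)) &&
    ((b \in map snd S) || (b + k \in map snd S)).
  move=> s s' s'' c; apply/andP; split; apply: contraT; rewrite negb_or => /andP[h1 h2].
    by case: (opposite_sides_free s s' s'' c).
  have := opposite_sides_free (small_side_swap s) (small_side_swap s') (small_side_swap s'').
  rewrite fst_swap => W; case: W => // i j ib ja; exact: c.
have h1 := opp _ _ _ _ _ _ s1 s2 s3 cov.
have h2 : ((a \in map fst S2) || (a + k \in map fst S2)) &&
    ((b \in map snd S2) || (b + k \in map snd S2)).
  by apply: (opp _ _ _ _ _ _ s2 s1 s3) => i j ia jb; rewrite orbCA cov.
have h3 : ((a \in map fst S3) || (a + k \in map fst S3)) &&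
    ((b \in map snd S3) || (b + k \in map snd S3)).
  apply: (opp _ _ _ _ _ _ s3 s1 s2) => i j ia jb.
  by rewrite orbC -orbA cov.
(* The booleans choose the sides to delete. Read as 0 or 1 they also shift the box: it starts at
   [a + 1] if column [a] goes, and at [a] if column [a + k] goes. *)
have corner (left low : bool) :
    let x := if left then a else a + k in let y := if low then b else b + k in
    ~~ [&& (x \in map fst S1) || (y \in map snd S1),
           (x \in map fst S2) || (y \in map snd S2) &
           (x \in map fst S3) || (y \in map snd S3)].
  move=> x y; apply/and3P => -[t1 t2 t3].
  have shrink S X : small_side a b k.+1 S X ->
      (x \in map fst S) || (y \in map snd S) ->
      small_side (a + left) (b + low) k
        [seq p <- S | inbox (a + left) (b + low) k p] X.
    apply: small_side_shrink;
    by rewrite /inside /x /y; case: (left); case: (low); clear; lia.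
  apply: IHk (shrink _ _ s1 t1) (shrink _ _ s2 t2) (shrink _ _ s3 t3) _.
  move=> i j ia jb.
  by apply: cov; move: ia jb; rewrite /inside; case: (left); case: (low); clear; lia.
move: h1 h2 h3 (corner true true) (corner true false) (corner false true)
  (corner false false) => /=.
exact: common_corner.
Qed.

(** * From the grid to boxes *)

(** Membership in [X] is constant on a row free of [S'], so such a row avoids [X], which contains no
    row. Some free row exists and crosses every free column, so free columns avoid [X] as well. *)
Lemma small_small_side n (X : {set grid n.+1}) : small X ->
  exists S, small_side 0 0 n.+1 S (fun i j => (inord i, inord j) \in X).
Proof.
case=> /mm_cover[S ltS covS] noRow.
pose S' := [seq (u.1 : nat, u.2 : nat) | u : grid n.+1 <- enum S].
have memS' i j : i < n.+1 -> j < n.+1 -> (inord i, inord j) \in S -> (i, j) \in S'.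
  move=> iN jN ijS; apply/mapP; exists (inord i, inord j); rewrite ?mem_enum //=.
  by rewrite !inordK.
have adjC (u v : grid n.+1) : grid_adj u v = grid_adj v u.
  by rewrite /grid_adj distnC [X in _ + X]distnC.
have cross u v : grid_adj u v -> (u \in X) != (v \in X) -> (u \in S) || (v \in S).
  have [uX|uX] := boolP (u \in X); have [vX|vX] := boolP (v \in X) => // uv _.
    exact: covS uv uX vX.
  by rewrite orbC; apply: covS vX uX; rewrite adjC.
have sep : separates 0 0 n.+1 S' (fun i j => (inord i, inord j) \in X).
  split=> i j /andP[_ i1] /andP[_ i2] /andP[_ i3] ne.
  - have adj : grid_adj ((inord i, inord j) : grid n.+1) (inord i.+1, inord j).
      by rewrite /grid_adj /= !inordK //; clear; lia.
    by case/orP: (cross _ _ adj ne) => /memS' ->; rewrite ?orbT.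
  - have adj : grid_adj ((inord i, inord j) : grid n.+1) (inord i, inord j.+1).
      by rewrite /grid_adj /= !inordK //; clear; lia.
    by case/orP: (cross _ _ adj ne) => /memS' ->; rewrite ?orbT.
have szS' : size S' < n.+1 by rewrite size_map -cardE.
have fr j : inside 0 n.+1 j -> j \notin map snd S' ->
    forall i, inside 0 n.+1 i -> (inord i, inord j) \notin X.
  move=> jb jS i ia; apply/negP => ijX; apply: (noRow (inord j)).
  apply/subsetP => -[u v]; rewrite inE /= => /eqP ->.
  have ua : inside 0 n.+1 u by rewrite /inside add0n ltn_ord.
  by have := row_const sep jb jS ua ia; rewrite inord_val => ->.
have szs : size (map snd S') < n.+1 by rewrite size_map.
have [r rb rS] := exists_free 0 szs.
exists S'; split=> // i ia iS j jb.
by rewrite (col_const sep ia iS jb rb); apply: fr.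
Qed.

Theorem lemma4p5 (k : nat) (hk : 2 <= k) (X1 X2 X3 : {set grid k})
  (hcover : X1 :|: X2 :|: X3 = [set: grid k]) :
  ~ small X1 \/ ~ small X2 \/ ~ small X3.
Proof.
case: k hk X1 X2 X3 hcover => // n _ X1 X2 X3 cov.
have dec (X : {set grid n.+1}) : small X \/ ~ small X.
  have [lt|ge] := ltnP (mm X) n.+1; last by right => -[]; rewrite ltnNge ge.
  have [/existsP[j rj]|nr] := boolP [exists j, grid_row j \subset X].
    by right => -[_ /(_ j)].
  by left; split=> // j rj; case/existsP: nr; exists j.
case: (dec X1) => [/small_small_side[S1 s1]|]; last by left.
case: (dec X2) => [/small_small_side[S2 s2]|]; last by right; left.
case: (dec X3) => [/small_small_side[S3 s3]|]; last by right; right.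
case: (small_sides_not_cover s1 s2 s3) => i j _ _.
by move/setP/(_ (inord i, inord j)): cov; rewrite !inE -orbA.
Qed.
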